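(* Let $f\in\mathcal R^0(\mathbb R^2)$ and write $f=\frac{p}{q}$ on $\mathrm{dom}(f)$ with $p,q\in\mathbb R[x,y]$ coprime, $q\ge 0$ on $\mathbb R^2$ and $q$ nonvanishing on $\mathrm{dom}(f)$. Then $f\in\mathcal R^0_{[1]}(\mathbb R^2)$ if and only if $q$ is locally positive definite at every point $a\in\mathrm{pol}(f)$.
   Context: For $k\in\mathbb N\cup\{\infty\}$ and $n\ge 1$, $\mathcal R^k(\mathbb R^n)$ denotes the ring of $k$-regulous functions: functions $f:\mathbb R^n\to\mathbb R$ of class $C^k$ for which there exist a nonempty Zariski open set $U\subseteq\mathbb R^n$ and polynomials $p,q$ with $q$ nonvanishing on $U$ and $f=p/q$ on $U$. Such an $f$ determines a rational function; $\mathrm{dom}(f)$ is the largest Zariski open set on which this rational function is regular (i.e. of the form $p/q$ with $q$ nonvanishing there), and $\mathrm{pol}(f)=\mathbb R^n\setminus\mathrm{dom}(f)$. Functions in $\mathcal R^0$ are called regulous. For $l\in\mathbb N$: consider compositions $\pi:M\to\mathbb R^2$ of successive blowings-up $M_i\to M_{i-1}$ ($M_0=\mathbb R^2$), each centred at points. An infinitely near point of order $j$ is a sequence $a_0\in M_0,\dots,a_j\in M_j$ where $M_i$ is the blowing-up of $M_{i-1}$ at $a_{i-1}$ and $a_i$ maps to $a_{i-1}$; the number of stages of $\pi$ is the maximal order of infinitely near points in $M$. $\mathcal R^k_{[l]}(\mathbb R^2)$ is the set of $f\in\mathcal R^k(\mathbb R^2)$ for which there is such a $\pi$ with at most $l$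 stages such that $f\circ\pi$ is regular on $M$. A polynomial $p\in\mathbb R[x,y]$ is locally positive definite at $a=(a_1,a_2)$ if, writing $p=\sum_{i\ge m}p_i$ with $p_i$ homogeneous of degree $i$ in the variables $(x-a_1,y-a_2)$ and $p_m\neq 0$, the lowest component $p_m$ is positive at every point of $\mathbb R^2$ other than $a$ (when $p(a)\ne 0$ this means $p(a)>0$). *)

(* Defs.v *)
From HB Require Import structures.
From Stdlib Require Import Reals Lra ClassicalEpsilon FunctionalExtensionality.
From mathcomp Require Import all_boot all_order all_algebra.
Set Implicit Arguments. Unset Strict Implicit. Unset Printing Implicit Defensive.
Import Order.TTheory GRing.Theory Num.Theory.

Definition Req_bool (x y : R) : bool := if Req_EM_T x y then true else false.
Lemma Req_boolP : Equality.axiom Req_bool.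
Proof. move=> x y; rewrite /Req_bool; case: Req_EM_T => h; constructor => //. Qed.
HB.instance Definition _ := hasDecEq.Build R Req_boolP.

Definition R_find (P : pred R) (n : nat) : option R :=
  let x := epsilon (inhabits R0) (fun x => P x) in if P x then Some x else None.
Lemma R_find_correct P n x : R_find P n = Some x -> P x.
Proof. rewrite /R_find; case: ifP => // h [<-] //. Qed.
Lemma R_find_complete (P : pred R) : (exists x, P x) -> exists n, R_find P n.
Proof.
move=> ex; exists 0%N; rewrite /R_find.
have := epsilon_spec (inhabits R0) (fun x => P x) ex.
by move=> ->.
Qed.
Lemma R_find_ext (P Q : pred R) : P =1 Q -> R_find P =1 R_find Q.
Proof. move=> h; have -> : P = Q by apply: functional_extensionality. by []. Qed.
HB.instance Definition _ := hasChoice.Build R R_find_correct R_find_complete R_find_ext.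

Lemma R_addA : associative Rplus. Proof. move=> *; ring. Qed.
Lemma R_addC : commutative Rplus. Proof. move=> *; ring. Qed.
Lemma R_add0 : left_id R0 Rplus. Proof. move=> *; ring. Qed.
Lemma R_addN : left_inverse R0 Ropp Rplus. Proof. move=> *; ring. Qed.
HB.instance Definition _ := GRing.isZmodule.Build R R_addA R_addC R_add0 R_addN.

Lemma R_mulA : associative Rmult. Proof. move=> *; ring. Qed.
Lemma R_mulC : commutative Rmult. Proof. move=> *; ring. Qed.
Lemma R_mul1 : left_id R1 Rmult. Proof. move=> *; ring. Qed.
Lemma R_mulD : left_distributive Rmult Rplus. Proof. move=> *; ring. Qed.
Lemma R_one_neq0 : R1 != R0.
Proof. apply/eqP; exact R1_neq_R0. Qed.
HB.instance Definition _ := GRing.Zmodule_isComNzRing.Build R R_mulA R_mulC R_mul1 R_mulD R_one_neq0.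

Definition R_inv (x : R) : R := if Req_EM_T x R0 then R0 else Rinv x.
Lemma R_mulV (x : R) : x != R0 -> Rmult (R_inv x) x = R1.
Proof. move=> /eqP h; rewrite /R_inv; destruct (Req_EM_T x R0) as [e|e]; [contradiction | exact: Rinv_l]. Qed.
Lemma R_inv0 : R_inv R0 = R0.
Proof. by rewrite /R_inv; case: Req_EM_T. Qed.
HB.instance Definition _ := GRing.ComNzRing_isField.Build R R_mulV R_inv0.

Local Open Scope ring_scope.
Definition R_leb (x y : R) : bool := if Rle_dec x y then true else false.
Definition R_ltb (x y : R) : bool := if Rlt_dec x y then true else false.
Lemma R_lebP x y : reflect (Rle x y) (R_leb x y).
Proof. rewrite /R_leb; case: Rle_dec => h; constructor => //. Qed.
Lemma R_ltbP x y : reflect (Rlt x y) (R_ltb x y).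
Proof. rewrite /R_ltb; case: Rlt_dec => h; constructor => //. Qed.

Lemma R_le0_add x y : R_leb 0 x -> R_leb 0 y -> R_leb 0 (x + y).
Proof. move=> /R_lebP h1 /R_lebP h2; apply/R_lebP; rewrite /GRing.add /=; lra. Qed.
Lemma R_le0_mul x y : R_leb 0 x -> R_leb 0 y -> R_leb 0 (x * y).
Proof. move=> /R_lebP h1 /R_lebP h2; apply/R_lebP; rewrite /GRing.mul /=; nra. Qed.
Lemma R_le0_anti x : R_leb 0 x -> R_leb x 0 -> x = 0.
Proof. move=> /R_lebP h1 /R_lebP h2; rewrite /GRing.zero /=; lra. Qed.
Lemma R_sub_ge0 x y : R_leb 0 (y - x) = R_leb x y.
Proof.
apply/idP/idP => /R_lebP h; apply/R_lebP; move: h; rewrite /GRing.add /GRing.opp /=; lra.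
Qed.
Lemma R_le0_total x : R_leb 0 x || R_leb x 0.
Proof. case: (Rle_dec 0 x) => h; [apply/orP; left | apply/orP; right]; apply/R_lebP; rewrite /GRing.zero /=; lra. Qed.
Lemma R_normN x : Rabs (- x) = Rabs x.
Proof. exact: Rabs_Ropp. Qed.
Lemma R_ge0_norm x : R_leb 0 x -> Rabs x = x.
Proof. move=> /R_lebP h; apply: Rabs_pos_eq; exact h. Qed.
Lemma R_lt_def x y : R_ltb x y = (y != x) && R_leb x y.
Proof.
apply/idP/idP.
- move=> /R_ltbP h; apply/andP; split; [apply/eqP; lra | apply/R_lebP; lra].
- move=> /andP [/eqP h1 /R_lebP h2]; apply/R_ltbP; lra.
Qed.
HB.instance Definition _ := Num.IntegralDomain_isLeReal.Build R
  R_le0_add R_le0_mul R_le0_anti R_sub_ge0 R_le0_total R_normN R_ge0_norm R_lt_def.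


(* Setting: the real plane R^2 = R * R (Stdlib reals, with the MathComp     *)
(* realFieldType structure declared above).  Real polynomials in two        *)
(* variables are elements of {poly {poly R}}: the outer variable is y, the  *)
(* coefficients are polynomials in x.                                       *)

Definition poly2 := {poly {poly R}}.

Definition Xvar : poly2 := ('X)%:P.
Definition Yvar : poly2 := 'X.

Definition ev2 (P : poly2) (z : R * R) : R := (P.[(z.2)%:P]).[z.1].

Definition dvd2 (d p : poly2) : Prop := exists r : poly2, p = r * d.
Definition coprime2 (p q : poly2) : Prop :=
  forall d : poly2, dvd2 d p -> dvd2 d q -> d \is a GRing.unit.

Definition zariski_open (U : R * R -> Prop) : Prop :=
  exists hs : seq poly2, forall z, U z <-> has (fun h => ev2 h z != 0) hs.

Definition continuous2 (f : R * R -> R) : Prop :=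
  forall z (eps : R), 0 < eps -> exists del : R, 0 < del /\
    forall w, `|w.1 - z.1| < del -> `|w.2 - z.2| < del -> `|f w - f z| < eps.

Definition regular_at (f : R * R -> R) (z : R * R) : Prop :=
  exists (U : R * R -> Prop) (P Q : poly2), zariski_open U /\ U z /\
    forall w, U w -> ev2 Q w != 0 /\ f w = ev2 P w / ev2 Q w.

Definition regulous (f : R * R -> R) : Prop :=
  continuous2 f /\
  exists (U : R * R -> Prop) (P Q : poly2), zariski_open U /\ (exists z, U z) /\
    forall w, U w -> ev2 Q w != 0 /\ f w = ev2 P w / ev2 Q w.

Definition in_dom (f : R * R -> R) (z : R * R) : Prop := regular_at f z.
Definition in_pol (f : R * R -> R) (z : R * R) : Prop := ~ in_dom f z.

(* The two standard affine charts of the blowing-up of R^2 at a point a.    *)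
(* The exceptional divisor is {u = 0} in the first chart, {t = 0} in the     *)
(* second; together they cover it.                                           *)
Definition bl_chart1 (a : R * R) (w : R * R) : R * R :=
  (a.1 + w.1, a.2 + w.1 * w.2).
Definition bl_chart2 (a : R * R) (w : R * R) : R * R :=
  (a.1 + w.1 * w.2, a.2 + w.2).

(* R^0_[1](R^2): regulous f such that f o pi is regular on M, where         *)
(* pi : M -> R^2 is a composition of blowings-up with at most one stage,    *)
(* i.e. the blowing-up of R^2 at a finite set S of points of R^2 (S empty   *)
(* gives pi = id).  Regularity of f o pi on M is checked on the open sets    *)
(* pi^-1(R^2 \ S) ~ R^2 \ S and on the two charts around each exceptional    *)
(* divisor pi^-1(a), a in S.                                                 *)
Definition regulous_1stage (f : R * R -> R) : Prop :=
  regulous f /\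
  exists S : seq (R * R),
    (forall z, z \notin S -> regular_at f z) /\
    (forall a, a \in S ->
       (forall v : R, regular_at (f \o bl_chart1 a) (0, v)) /\
       (forall t : R, regular_at (f \o bl_chart2 a) (t, 0))).

Definition shift2 (P : poly2) (a : R * R) : poly2 :=
  map_poly (fun c : {poly R} => c \Po ('X + (a.1)%:P)) (P \Po ('X + ((a.2)%:P)%:P)).

Definition hcomp (Q : poly2) (i : nat) : poly2 :=
  \sum_(j < i.+1) (((Q`_j)`_(i - j)) *: 'X^(i - j))%:P * 'X^j.

Definition loc_pos_def (p : poly2) (a : R * R) : Prop :=
  exists m : nat,
    hcomp (shift2 p a) m != 0 /\
    (forall i, (i < m)%N -> hcomp (shift2 p a) i = 0) /\
    (forall w : R * R, w != a -> 0 < ev2 (hcomp (shift2 p a) m) (w.1 - a.1, w.2 - a.2)).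

(* Main.v *)
Require Import Defs.
From Stdlib Require Import Reals Classical_Prop.
From mathcomp Require Import all_boot all_order all_algebra ring lra.
Set Implicit Arguments. Unset Strict Implicit. Unset Printing Implicit Defensive.
Import Order.TTheory GRing.Theory Num.Theory.
Local Open Scope ring_scope.

(** By continuity [f q = p] on the whole plane, so [pol f] is the zero set of
    [q], contained in the common zero set of [p] and [q], hence finite.  Near
    [a] in [pol f], let [m] be the order of [q] at [a] and [H] its lowest
    homogeneous component.  In a chart [(u, v)] of the blowing-up at [a] with
    exceptional line [u = 0] we have [q = u^m qt], where [qt (0, v)] is the
    value of [H] in the direction given by [v]; as [q >= 0], also [H >= 0], so
    local positive definiteness means that [qt] never vanishes on the
    exceptional lines.

    If [qt (0, v) <> 0], then [f qt] is continuous and [u^m (f qt) = p] is a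
    polynomial, so [f qt] is itself a polynomial and [f] is regular at [(0, v)].

    Conversely, let [f = P / Q] near [(0, v)].  Gauss' lemma turns coprimality
    into a Bezout relation [A p + B q = r (x)] with [r <> 0], so that
    [r Q = (A P + B Q) u^m qt].  Since [u] does not divide [qt], the powers of
    [u] dividing [r] can be cancelled, and then [qt (0, v) = 0] would force
    [Q (0, v) = 0]. *)

(** * Gauss' lemma and the Bezout relation *)

Section GaussLemma.
Variable F : fieldType.
Implicit Types (c r : {poly F}) (D s t p q : {poly {poly F}}).

Lemma scale_dvd_coef r D : (forall i, r %| D`_i) -> exists D1, D = r *: D1.
Proof.
move=> h; exists (\poly_(i < size D) (D`_i %/ r)); apply/polyP => i.
rewrite coefZ coef_poly; case: ltnP => [_|hi]; last by rewrite nth_default ?mulr0.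
by rewrite mulrC divpK.
Qed.

(** Reduce all coefficients modulo [r]. If neither reduction vanishes, both leading coefficients are
    prime to [r], hence so is that of the product, although [r] divides it. *)
Lemma irreducible_scale_dvdM r D s : irreducible_poly r ->
  (exists E, D * s = r *: E) ->
  (exists D1, D = r *: D1) \/ (exists s1, s = r *: s1).
Proof.
move=> irr [E hE].
pose red (P : {poly {poly F}}) := \poly_(i < size P) (P`_i %% r).
have redE P : exists P1, P = r *: P1 + red P.
  have [i|P1 hP1] := @scale_dvd_coef r (P - red P).
    rewrite coefB coef_poly; case: ltnP => [_|hi].
      by rewrite [X in X - _](divp_eq P`_i r) addrK dvdp_mull.
    by rewrite nth_default ?subr0 ?dvdp0.
  by exists P1; rewrite -hP1 subrK.
(* The coefficients of [red P] are remainders, of smaller size than [r], so [r] divides only those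
   that are zero. *)
have red_lead P : red P != 0 -> ~~ (r %| lead_coef (red P)).
  move=> nz; apply/negP => /dvdp_leq; rewrite lead_coef_eq0 => /(_ nz).
  rewrite leqNgt lead_coefE coef_poly; case: (ltnP _ (size P)) => _.
    by rewrite ltn_modp irredp_neq0.
  by rewrite size_poly0 size_poly_gt0 irredp_neq0.
have [D1 hD] := redE D; have [s1 hs] := redE s.
have [D0|nzD] := eqVneq (red D) 0.
  by left; exists D1; rewrite {1}hD D0 addr0.
have [s0|nzs] := eqVneq (red s) 0.
  by right; exists s1; rewrite {1}hs s0 addr0.
have dvdE : red D * red s = r *: (E - D1 * s - red D * s1).
  have eD : red D = D - r%:P * D1 by rewrite {2}hD mul_polyC addrC addKr.
  have es : red s = s - r%:P * s1 by rewrite {2}hs mul_polyC addrC addKr.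
  by rewrite -mul_polyC !mulrBr mul_polyC -hE eD es; ring.
have := red_lead _ nzD; have := red_lead _ nzs.
rewrite -!irreducible_poly_coprime // => cs cD.
have : coprimep r (lead_coef (red D * red s)) by rewrite lead_coefM coprimepMr cD.
by rewrite irreducible_poly_coprime // dvdE lead_coefZ dvdp_mulIl.
Qed.

Lemma irreducible_factor c : (1 < size c)%N ->
  exists2 r, irreducible_poly r & r %| c.
Proof.
have [n] := ubnP (size c); elim: n c => // n IH c hn hc.
have [[r hr]|no] :=
  classic (exists r, [/\ (1 < size r)%N, r %| c & (size r < size c)%N]).
  have [h1 h2 h3] := hr.
  have [r' irr' d'] := IH r (leq_trans h3 hn) h1.
  by exists r' => //; apply: dvdp_trans d' h2.
exists c => //; split=> // d hd dc.
have cnz : c != 0 by rewrite -size_poly_gt0 ltnW.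
rewrite -(dvdp_size_eqp dc) eqn_leq (dvdp_leq cnz dc) leqNgt.
apply/negP => lt; apply: no; exists d; split=> //.
have dnz : d != 0 by apply: contraNneq cnz => d0; rewrite d0 dvd0p in dc.
by rewrite ltn_neqAle eq_sym hd size_poly_gt0.
Qed.

(** Descends a common divisor over the fraction field to one over [{poly F}]. The irreducible
    factors of [c] are cancelled one at a time: each divides [D], or else both [s] and [t]. The
    degree in y of [D] is kept, so a nonconstant divisor stays a nonunit. *)
Lemma common_divisor_of_scaled c D p q s t : c != 0 ->
  c *: p = s * D -> c *: q = t * D ->
  exists s' t' D', [/\ p = s' * D', q = t' * D' & size D' = size D].
Proof.
have [n] := ubnP (size c); elim: n c D s t => // n IH c D s t hn cnz hp hq.
have [c1|c1] := leqP (size c) 1.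
  (* A constant [c] is invertible and is absorbed into [s] and [t]. *)
  have := size1_polyC c1; set a := c`_0 => ca.
  have anz : a != 0 by move: cnz; rewrite ca polyC_eq0.
  have inv P : (a^-1)%:P *: (c *: P) = P.
    by rewrite scalerA ca -polyCM mulVf // scale1r.
  exists ((a^-1)%:P *: s), ((a^-1)%:P *: t), D.
  by rewrite -!scalerAl -hp -hq !inv.
have [r irr rc] := irreducible_factor c1.
have rnz : r != 0 := irredp_neq0 irr.
have rinj (P Q : {poly {poly F}}) : r *: P = r *: Q -> P = Q.
  by rewrite -!mul_polyC; apply: mulfI; rewrite polyC_eq0.
have cE : c = r * (c %/ r) by rewrite mulrC divpK.
have c'nz : c %/ r != 0 by apply: contraNneq cnz => e; rewrite cE e mulr0.
have ltc : (size (c %/ r)%R < n)%N.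
  rewrite ltnS in hn; apply: leq_trans hn.
  rewrite size_divp //; case: irr => hr _.
  by case: (size r) hr => [|[|k]] //= _; rewrite ltn_subrL /= ltnW.
have hp' : s * D = r *: ((c %/ r) *: p) by rewrite scalerA -cE.
have hq' : t * D = r *: ((c %/ r) *: q) by rewrite scalerA -cE.
have [[D1 hD]|nD] := classic (exists D1, D = r *: D1).
  have [||s' [t' [D' [h1 h2 h3]]]] := IH _ D1 s t ltc c'nz.
  - by apply: rinj; rewrite -hp' hD scalerAr.
  - by apply: rinj; rewrite -hq' hD scalerAr.
  by exists s', t', D'; split=> //; rewrite h3 hD size_scale.
have [[s1 hs]|//] := irreducible_scale_dvdM irr (ex_intro _ _ hp').
have [[t1 ht]|//] := irreducible_scale_dvdM irr (ex_intro _ _ hq').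
apply: (IH _ D s1 t1 ltc c'nz).
- by apply: rinj; rewrite -hp' hs scalerAl.
- by apply: rinj; rewrite -hq' ht scalerAl.
Qed.

End GaussLemma.

(** Up to scalars in x, [gcdp] is the gcd over the fraction field in x. If it involved y, clearing
    denominators would give a nonunit common divisor; hence it is free of y, and its Bezout relation
    is the one sought. *)
Lemma coprime2_bezout (p q : poly2) : coprime2 p q ->
  exists A B (r : {poly R}), r != 0 /\ A * p + B * q = r%:P.
Proof.
move=> cop; set g := gcdp p q.
have [g1|g1] := leqP (size g) 1; last first.
  have /Pdiv.Idomain.dvdpP [[c s] /= cnz hs] : g %| p by apply: dvdp_gcdl.
  have /Pdiv.Idomain.dvdpP [[d t] /= dnz ht] : g %| q by apply: dvdp_gcdr.
  have [|||s' [t' [D [h1 h2 h3]]]] :=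
    @common_divisor_of_scaled _ (c * d) g p q (d *: s) (c *: t).
  - by rewrite mulf_neq0.
  - by rewrite mulrC -scalerA hs scalerAl.
  - by rewrite -scalerA ht scalerAl.
  have : D \is a GRing.unit by apply: cop; [exists s' | exists t'].
  by rewrite poly_unitE h3 => /andP[/eqP e]; rewrite e in g1.
have [[A B] /=] := Pdiv.Idomain.Bezoutp p q.
case/Pdiv.Idomain.eqpP => [[c d]] /= /andP[cnz dnz].
rewrite -/g (size1_polyC g1) => e.
exists (c *: A), (c *: B), (d * g`_0); split; last first.
  by rewrite -!scalerAl -scalerDr e -mul_polyC polyCM.
(* If [g] were zero, [p] and [q] would be too, and 0 would be a common divisor, hence a unit. *)
rewrite mulf_neq0 // -polyC_eq0 -size1_polyC // gcdp_eq0.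
apply/negP => /andP[/eqP p0 /eqP q0].
have : (0 : poly2) \is a GRing.unit.
  by apply: cop; exists 0; rewrite ?p0 ?q0 mul0r.
by rewrite unitr0.
Qed.

(** * Evaluation, substitution and homogeneous components *)

Section Evaluation.
Implicit Types (P Q T : poly2) (z w a : R * R).

Lemma ev2D P Q z : ev2 (P + Q) z = ev2 P z + ev2 Q z.
Proof. by rewrite /ev2 !hornerD. Qed.

Lemma ev2N P z : ev2 (- P) z = - ev2 P z.
Proof. by rewrite /ev2 !hornerN. Qed.

Lemma ev2M P Q z : ev2 (P * Q) z = ev2 P z * ev2 Q z.
Proof. by rewrite /ev2 !hornerM. Qed.

Lemma ev2X P n z : ev2 (P ^+ n) z = ev2 P z ^+ n.
Proof. by rewrite /ev2 !horner_exp. Qed.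

Lemma ev2C (r : {poly R}) z : ev2 r%:P z = r.[z.1].
Proof. by rewrite /ev2 hornerC. Qed.

Lemma ev2_1 z : ev2 1 z = 1.
Proof. by rewrite ev2C hornerC. Qed.

Lemma ev2_0 z : ev2 0 z = 0.
Proof. by rewrite ev2C horner0. Qed.

Lemma ev2_Xvar z : ev2 Xvar z = z.1.
Proof. by rewrite ev2C hornerX. Qed.

Lemma ev2_Yvar z : ev2 Yvar z = z.2.
Proof. by rewrite /ev2 hornerX hornerC. Qed.

Lemma ev2_sum (I : Type) (s : seq I) (D : pred I) (E : I -> poly2) z :
  ev2 (\sum_(i <- s | D i) E i) z = \sum_(i <- s | D i) ev2 (E i) z.
Proof. by rewrite /ev2 !horner_sum. Qed.

Lemma ev2_coefE P z : ev2 P z = \sum_(j < size P) (P`_j).[z.1] * z.2 ^+ j.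
Proof.
rewrite /ev2 (horner_coef P) horner_sum; apply: eq_bigr => j _.
by rewrite hornerM horner_exp hornerC.
Qed.

Definition comp2 P (A B : poly2) : poly2 :=
  \sum_(j < size P) (\sum_(i < size P`_j) (P`_j`_i)%:P%:P * A ^+ i) * B ^+ j.

Lemma ev2_comp2 P A B z : ev2 (comp2 P A B) z = ev2 P (ev2 A z, ev2 B z).
Proof.
rewrite [RHS]ev2_coefE /comp2 ev2_sum; apply: eq_bigr => j _.
rewrite ev2M ev2X ev2_sum horner_coef /=; congr (_ * _).
by apply: eq_bigr => i _; rewrite ev2M ev2X ev2C hornerC.
Qed.

(** There are more roots than the degree allows. The embedding [e] lets one argument serve for x,
    with real coefficients, and for y, with reals as constants of [{poly R}]. *)
Lemma poly_eq0_interval (A : idomainType) (e : R -> A) (x d : R) (r : {poly A}) :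
  injective e -> 0 < d ->
  (forall y, `|y - x| < d -> r.[e y] = 0) -> r = 0.
Proof.
move=> inj d0 h; apply/eqP/negPn/negP => rnz.
pose n := size r.
(* Denominators start at 2, which keeps the points strictly within [d] of [x]. *)
pose pt (i : nat) : R := x + d * (i.+2%:R)^-1.
have ptinj : injective pt.
  move=> i j /addrI /(mulfI (lt0r_neq0 d0)) /invr_inj /eqP.
  by rewrite eqr_nat => /eqP [].
have := @max_poly_roots A r [seq e (pt i) | i <- iota 0 n] rnz.
rewrite size_map size_iota ltnn => H; apply: notF; apply: H.
  apply/allP => _ /mapP[i _ ->]; apply/rootP/h.
  rewrite /pt addrC addKr normrM gtr0_norm // gtr_pMr // ger0_norm ?invr_ge0 ?ler0n //.
  by rewrite invf_lt1 ?ltr0n // ltr1n.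
by rewrite map_inj_uniq ?iota_uniq // => i j /inj/ptinj.
Qed.

Lemma ev2_eq0_box P z (d : R) : 0 < d ->
  (forall w, `|w.1 - z.1| < d -> `|w.2 - z.2| < d -> ev2 P w = 0) -> P = 0.
Proof.
move=> d0 h; apply: (@poly_eq0_interval _ (@polyC R) z.2 d) => //.
  exact: polyC_inj.
move=> y hy; apply: (@poly_eq0_interval _ id z.1 d) => // x hx.
exact: (h (x, y)).
Qed.

Lemma ev2_inj P Q : (forall w, ev2 P w = ev2 Q w) -> P = Q.
Proof.
move=> h; apply/eqP; rewrite -subr_eq0; apply/eqP.
apply: (@ev2_eq0_box _ (0, 0) 1 ltr01) => w _ _.
by rewrite ev2D ev2N h subrr.
Qed.

(** The products with [H] agree everywhere, so an identity need only be checked where a denominator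
    is nonzero. *)
Lemma ev2_eq_of_mul (H P Q : poly2) : H != 0 ->
  (forall w, ev2 H w != 0 -> ev2 P w = ev2 Q w) -> P = Q.
Proof.
move=> Hnz h; apply: (mulfI Hnz); apply: ev2_inj => w; rewrite !ev2M.
by have [->|/h->] := eqVneq (ev2 H w) 0; rewrite ?mul0r.
Qed.

Lemma ev2_neq0 P w : ev2 P w != 0 -> P != 0.
Proof. by apply: contraNneq => ->; rewrite /ev2 !horner0. Qed.

Lemma Xvar_neq0 : Xvar != 0.
Proof. by apply: (@ev2_neq0 _ (1, 0)); rewrite ev2_Xvar oner_eq0. Qed.

(** Setting x = 0 in the coefficients leaves a polynomial in y with every real as a root, so each
    coefficient has root 0. *)
Lemma Xvar_dvd P : (forall y, ev2 P (0, y) = 0) -> exists P1, P = Xvar * P1.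
Proof.
move=> h; have P0 : map_poly (horner_eval 0) P = 0.
  apply: (@poly_eq0_interval _ id 0 1) => // y _.
  have := horner_map (horner_eval (0 : R)) P y%:P.
  by rewrite /= !horner_evalE hornerC => ->; apply: h.
have [i|P1 ->] := @scale_dvd_coef _ 'X P; last by exists P1; rewrite mul_polyC.
rewrite -['X]subr0 -polyC0; apply/Pdiv.Idomain.polyXsubCP.
by have /polyP/(_ i) := P0; rewrite coef_map coef0.
Qed.

Lemma ev2_shift2 P a w : ev2 (shift2 P a) w = ev2 P (a.1 + w.1, a.2 + w.2).
Proof.
rewrite /ev2 /shift2 /=.
have -> : (w.2)%:P = (w.2)%:P \Po ('X + a.1%:P) by rewrite comp_polyC.
rewrite (horner_map (comp_poly ('X + a.1%:P))) /= !horner_comp.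
by rewrite !hornerE /= -polyCD (addrC w.1) (addrC w.2).
Qed.

Lemma ev2_hcomp Q i w :
  ev2 (hcomp Q i) w = \sum_(j < i.+1) Q`_j`_(i - j) * w.1 ^+ (i - j) * w.2 ^+ j.
Proof.
rewrite ev2_sum; apply: eq_bigr => j _.
rewrite ev2M ev2C hornerZ hornerXn; congr (_ * _).
by rewrite -/Yvar ev2X ev2_Yvar.
Qed.

Lemma ev2_hcompZ Q i (s : R) w :
  ev2 (hcomp Q i) (s * w.1, s * w.2) = s ^+ i * ev2 (hcomp Q i) w.
Proof.
rewrite !ev2_hcomp mulr_sumr; apply: eq_bigr => j _ /=.
have hj : (j <= i)%N by rewrite -ltnS.
have -> : s ^+ i = s ^+ (i - j) * s ^+ j by rewrite -exprD subnK.
by rewrite !exprMn; ring.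
Qed.

Lemma ev2_sum_hcomp Q : exists N0, forall N w, (N0 <= N)%N ->
  ev2 Q w = \sum_(i < N) ev2 (hcomp Q i) w.
Proof.
pose M := (\max_(j < size Q) size (Q`_j)%R)%N.
have hM j : (size (Q`_j)%R <= M)%N.
  have [lt|ge] := ltnP j (size Q); last by rewrite nth_default // size_poly0.
  exact: (@leq_bigmax _ (fun j : 'I_(size Q) => size Q`_j) (Ordinal lt)).
(* This bound exceeds the total degree of every monomial of [Q]. *)
exists (size Q + M)%N => N w leN.
have leQ : (size Q <= N)%N := leq_trans (leq_addr _ _) leN.
under eq_bigr => i _ do rewrite ev2_hcomp.
transitivity (\sum_(0 <= i < N) \sum_(0 <= j < N | (j < i.+1)%N)
    Q`_j`_(i - j) * w.1 ^+ (i - j) * w.2 ^+ j); last first.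
  rewrite big_mkord; apply: eq_bigr => i _.
  by rewrite -(big_mkord xpredT (fun j => Q`_j`_(i - j) * w.1 ^+ (i - j) * w.2 ^+ j))
     (big_nat_widen _ _ N).
(* For fixed [j] the total degree [i] runs from [j] to [N - 1]; the index [k = i - j] then runs over
   the powers of x. *)
rewrite (exchange_big_dep_nat xpredT) //=.
rewrite ev2_coefE (big_ord_widen_cond N xpredT (fun j => (Q`_j).[w.1] * w.2 ^+ j)) //=.
rewrite big_mkord big_mkcond /=; apply: eq_bigr => j _.
have [lt|ge] := ltnP j (size Q); last first.
  by rewrite big1 // => i _; rewrite (nth_default _ ge) coef0 !mul0r.
rewrite -(@big_nat_widenl _ _ _ j 0 N xpredT) // -[X in index_iota X]add0n big_addn.
rewrite (@horner_coef_wide _ (N - j)); last first.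
  apply: leq_trans (hM j) _; rewrite leq_subRL ?(ltnW (ltn_ord j)) //.
  by apply: leq_trans leN; rewrite leq_add2r ltnW.
rewrite mulr_suml big_mkord; apply: eq_bigr => k _; by rewrite addnK.
Qed.

End Evaluation.

(** * Continuous functions and division by powers of x *)

Section Continuity.
Implicit Types (f g : R * R -> R) (P : poly2) (z w : R * R).

Lemma continuous2_cst (c : R) : continuous2 (fun=> c).
Proof. by move=> z e e0; exists 1; split=> // w _ _; rewrite subrr normr0. Qed.

Lemma continuous2_fst : continuous2 fst.
Proof. by move=> z e e0; exists e. Qed.

Lemma continuous2_snd : continuous2 snd.
Proof. by move=> z e e0; exists e. Qed.

Lemma continuous2D f g : continuous2 f -> continuous2 g ->
  continuous2 (fun w => f w + g w).
Proof.
move=> cf cg z e e0.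
have [d [d0 hf]] := cf z (e / 2) ltac:(lra).
have [d' [d'0 hg]] := cg z (e / 2) ltac:(lra).
exists (Num.min d d'); split=> [|w]; first by rewrite lt_min d0.
rewrite !lt_min => /andP[a1 a2] /andP[b1 b2].
have := hf w a1 b1; have := hg w a2 b2.
have := ler_normD (f w - f z) (g w - g z).
have -> : f w - f z + (g w - g z) = f w + g w - (f z + g z) by ring.
lra.
Qed.

Lemma continuous2M f g : continuous2 f -> continuous2 g ->
  continuous2 (fun w => f w * g w).
Proof.
move=> cf cg z e e0.
(* The three error terms below add up to less than [e' * K]; the bound [e' <= 1] controls the
   product [F * G]. *)
pose K := 2 + `|f z| + `|g z|.
have K0 : 0 < K by rewrite /K; have := normr_ge0 (f z); have := normr_ge0 (g z); lra.
pose e' := Num.min 1 (e / K).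
have e'0 : 0 < e' by rewrite lt_min ltr01 divr_gt0.
have e'1 : e' <= 1 by rewrite ge_min lexx.
have e'K : e' * K <= e by rewrite -ler_pdivlMr // ge_min lexx orbT.
have [d [d0 hf]] := cf z e' e'0.
have [d' [d'0 hg]] := cg z e' e'0.
exists (Num.min d d'); split=> [|w]; first by rewrite lt_min d0.
rewrite !lt_min => /andP[a1 a2] /andP[b1 b2].
have := hf w a1 b1; have := hg w a2 b2.
set F := f w - f z; set G := g w - g z => hG hF.
have -> : f w * g w - f z * g z = F * G + f z * G + F * g z by rewrite /F /G; ring.
have := ler_normD (F * G + f z * G) (F * g z); have := ler_normD (F * G) (f z * G).
rewrite !normrM; move: e'K; rewrite /K.
have := normr_ge0 F; have := normr_ge0 G; have := normr_ge0 (f z); have := normr_ge0 (g z).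
move: `|F| `|G| `|f z| `|g z| hF hG => x y u v; nra.
Qed.

Lemma continuous2_comp f g h : continuous2 f -> continuous2 g -> continuous2 h ->
  continuous2 (fun w => f (g w, h w)).
Proof.
move=> cf cg ch z e e0.
have [d [d0 hf]] := cf (g z, h z) e e0.
have [d1 [d10 hg]] := cg z d d0.
have [d2 [d20 hh]] := ch z d d0.
exists (Num.min d1 d2); split=> [|w]; first by rewrite lt_min d10.
by rewrite !lt_min => /andP[a1 a2] /andP[b1 b2]; apply: hf; [apply: hg|apply: hh].
Qed.

Lemma continuous2_ext f g : f =1 g -> continuous2 f -> continuous2 g.
Proof.
move=> e cf z eps eps0; have [d [d0 h]] := cf z eps eps0.
by exists d; split=> // w a b; rewrite -!e; apply: h.
Qed.

Lemma continuous2_ev2 P : continuous2 (ev2 P).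
Proof.
have inner (c : {poly R}) : continuous2 (fun w => c.[w.1]).
  elim/poly_ind: c => [|c x IH].
    by apply: continuous2_ext (continuous2_cst 0) => w; rewrite horner0.
  apply: continuous2_ext (continuous2D (continuous2M IH continuous2_fst) (continuous2_cst x)).
  by move=> w; rewrite hornerMXaddC.
elim/poly_ind: P => [|P c IH].
  by apply: continuous2_ext (continuous2_cst 0) => w; rewrite /ev2 !horner0.
apply: continuous2_ext (continuous2D (continuous2M IH continuous2_snd) (inner c)).
by move=> w; rewrite ev2D ev2M ev2C -ev2_Yvar.
Qed.

(** Where [f] is nonzero it stays nonzero on a box; [P] would vanish on that box and so be zero. *)
Lemma continuous2_eq0_dense f P : continuous2 f -> P != 0 ->
  (forall w, ev2 P w != 0 -> f w = 0) -> forall z, f z = 0.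
Proof.
move=> cf Pnz h z; apply/eqP/negPn/negP => fz.
have [|d [d0 hd]] := cf z `|f z|; first by rewrite normr_gt0.
case/negP: Pnz; apply/eqP; apply: (ev2_eq0_box d0) => w a b.
apply/eqP/negPn/negP => /h fw; have := hd w a b.
by rewrite fw sub0r normrN ltxx.
Qed.

(** The polynomial [P] vanishes on the line x = 0, so one factor x cancels off that line, and
    continuity extends the identity across it. *)
Lemma continuous2_divXn f m P : continuous2 f ->
  (forall w, w.1 ^+ m * f w = ev2 P w) -> exists P1, forall w, f w = ev2 P1 w.
Proof.
move=> cf; elim: m P => [|m IH] P h.
  by exists P => w; rewrite -h expr0 mul1r.
have [y|P1 hP] := @Xvar_dvd P; first by rewrite -h exprS mul0r mul0r.
apply: (IH P1) => w; apply/eqP; rewrite -subr_eq0; apply/eqP; move: w.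
apply: (@continuous2_eq0_dense _ Xvar _ Xvar_neq0) => [|w].
  apply: continuous2_ext (continuous2D
    (continuous2M (continuous2_ev2 (Xvar ^+ m)) cf) (continuous2_ev2 (- P1))) => w.
  by rewrite ev2N ev2X ev2_Xvar.
rewrite ev2_Xvar => w0; apply: (mulfI w0).
by rewrite mulr0 mulrBr mulrA -exprS h hP ev2M ev2_Xvar subrr.
Qed.

End Continuity.

(** * Cancellation along the exceptional line *)

Section ExceptionalLine.
Implicit Types (Q T P : poly2).

(** Induction on the size of [r]. If [r] is nonzero at 0, evaluate at [(0, v0)]. Otherwise [P * T]
    vanishes on x = 0, where [P] is not identically zero, so x divides both [r] and [T] and
    cancels. *)
Lemma dvd_on_exceptional (r : {poly R}) Q T P v0 : r != 0 ->
  r%:P * Q = P * T -> (exists v, ev2 P (0, v) != 0) ->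
  ev2 P (0, v0) = 0 -> ev2 Q (0, v0) = 0.
Proof.
move=> rnz e [v Pv] P0; have [n] := ubnP (size r).
elim: n r T rnz e => // n IH r T rnz e hn.
have E w : r.[w.1] * ev2 Q w = ev2 P w * ev2 T w by rewrite -ev2C -!ev2M e.
have [r0|r0] := eqVneq r.[0] 0; last first.
  by have /eqP := E (0, v0); rewrite P0 mul0r mulf_eq0 (negPf r0) => /eqP.
have [T1 hT] : exists T1, T = Xvar * T1.
  apply: Xvar_dvd => y.
  have -> : ev2 T (0, y) = ev2 (comp2 T 0 Yvar) (0, y).
    by rewrite ev2_comp2 ev2_Yvar ev2_0.
  suff -> : comp2 T 0 Yvar = 0 by rewrite ev2_0.
  apply: (@ev2_eq_of_mul (comp2 P 0 Yvar)).
    by apply: (@ev2_neq0 _ (0, v)); rewrite ev2_comp2 ev2_Yvar ev2_0.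
  move=> w; rewrite !ev2_comp2 !ev2_0 ev2_Yvar => /mulfI; apply.
  by rewrite -E /= r0 mul0r mulr0.
have /factor_theorem [r1 hr] : root r 0 by apply/rootP.
rewrite subr0 in hr.
have r1nz : r1 != 0 by apply: contraNneq rnz => z; rewrite hr z mul0r.
apply: (IH r1 T1 r1nz); last by move: hn; rewrite hr size_mulX.
apply: (mulfI Xvar_neq0); rewrite [RHS]mulrCA -hT -e hr polyCM /Xvar.
by rewrite mulrA [_ * r1%:P]mulrC.
Qed.

End ExceptionalLine.

(** * Exchange of the coordinates *)

Section Swap.
Implicit Types (f : R * R -> R) (P : poly2) (z w : R * R).

Lemma ev2_swapXY P w : ev2 (swapXY P) w = ev2 P (w.2, w.1).
Proof. exact: horner2_swapXY. Qed.

Lemma coprime2_swapXY p q : coprime2 p q -> coprime2 (swapXY p) (swapXY q).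
Proof.
move=> cop d [s hs] [t ht].
have : swapXY d \is a GRing.unit.
  apply: cop; [exists (swapXY s)|exists (swapXY t)].
    by rewrite -rmorphM -hs /= swapXYK.
  by rewrite -rmorphM -ht /= swapXYK.
case/unitrPr => e /(congr1 swapXY); rewrite rmorphM rmorph1 /= swapXYK => de.
by apply/unitrPr; exists (swapXY e).
Qed.

Lemma coprime2_bezoutY p q : coprime2 p q ->
  exists A B (r : {poly R}), r != 0 /\
    forall z, ev2 A z * ev2 p z + ev2 B z * ev2 q z = r.[z.2].
Proof.
move/coprime2_swapXY/coprime2_bezout => [A [B [r [rnz e]]]].
exists (swapXY A), (swapXY B), r; split=> // z.
have := congr1 (fun P => ev2 P (z.2, z.1)) e.
by rewrite ev2D !ev2M ev2C !ev2_swapXY /= -surjective_pairing.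
Qed.

Lemma regular_at_ext f g z : f =1 g -> regular_at f z -> regular_at g z.
Proof.
move=> e [U [P [Q [zU [Uz h]]]]]; exists U, P, Q; split=> //; split=> // w.
by rewrite -e; apply: h.
Qed.

Lemma regular_at_swap f z : regular_at f (z.2, z.1) ->
  regular_at (fun w => f (w.2, w.1)) z.
Proof.
move=> [U [P [Q [[hs hU] [Uz h]]]]].
exists (fun w => U (w.2, w.1)), (swapXY P), (swapXY Q); split.
  exists [seq swapXY h | h <- hs] => w; rewrite hU has_map.
  by split; apply: sub_has => k /=; rewrite ev2_swapXY.
by split=> // w /h; rewrite !ev2_swapXY.
Qed.

End Swap.

(** * Basic open sets, quotients and root sets *)

Lemma zariski_open_basis U z : zariski_open U -> U z ->
  exists H : poly2, ev2 H z != 0 /\ forall w, ev2 H w != 0 -> U w.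
Proof.
move=> [hs hU] /hU /hasP [H Hin Hz]; exists H; split=> // w Hw.
by apply/hU/hasP; exists H.
Qed.

Lemma regular_at_quotient (f : R * R -> R) (P Q : poly2) z :
  (forall w, f w * ev2 Q w = ev2 P w) -> ev2 Q z != 0 -> regular_at f z.
Proof.
move=> h Qz; exists (fun w => ev2 Q w != 0), P, Q; split.
  by exists [:: Q] => w /=; rewrite orbF.
by split=> // w Qw; split=> //; rewrite -h mulfK.
Qed.

Lemma roots_finite (A : idomainType) (r : {poly A}) : r != 0 ->
  exists s : seq A, forall x, r.[x] = 0 -> x \in s.
Proof.
have [n] := ubnP (size r); elim: n r => // n IH r hn rnz.
have [[x /rootP rx]|no] := classic (exists x, r.[x] = 0); last first.
  by exists [::] => x rx; case: no; exists x.
have [r1 hr] := factor_theorem _ _ rx.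
have r1nz : r1 != 0 by apply: contraNneq rnz => e; rewrite hr e mul0r.
have [|s hs] := IH r1 _ r1nz.
  by move: hn; rewrite hr size_Mmonic ?monicXsubC // size_XsubC addn2.
exists (x :: s) => y; rewrite hr hornerM hornerXsubC inE => /eqP.
by rewrite mulf_eq0 subr_eq0 orbC => /orP[->//|/eqP/hs->]; rewrite orbT.
Qed.

(** * The lowest homogeneous component *)

Section TangentCone.
Implicit Types (Q H : poly2) (a w : R * R).

Lemma lowest_hcomp Q : Q != 0 ->
  exists m, hcomp Q m != 0 /\ forall i, (i < m)%N -> hcomp Q i = 0.
Proof.
move=> Qnz.
have ex : exists m, hcomp Q m != 0.
  apply: NNPP => no; case/negP: Qnz; apply/eqP; apply: ev2_inj => w.
  have [N /(_ N w (leqnn N)) ->] := ev2_sum_hcomp Q.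
  rewrite ev2_0 big1 // => i _.
  suff -> : hcomp Q i = 0 by rewrite ev2_0.
  by apply/eqP/negPn/negP => h; apply: no; exists i.
exists (ex_minn ex); case: ex_minnP => m hm lo; split=> // i lt.
by apply/eqP/negPn/negP => /lo; rewrite leqNgt lt.
Qed.

(** The component of degree i scales by [s ^+ i]. As [n] depends on neither [s] nor [w], the bracket
    can later be read as a polynomial. *)
Lemma ev2_lowest_expansion Q m : (forall i, (i < m)%N -> hcomp Q i = 0) ->
  exists n, forall (s : R) w, ev2 Q (s * w.1, s * w.2) =
    s ^+ m * (ev2 (hcomp Q m) w +
              s * \sum_(i < n) s ^+ i * ev2 (hcomp Q (m + i.+1)) w).
Proof.
move=> lo; have [n hn] := ev2_sum_hcomp Q; exists n => s w.
rewrite (hn (m + n.+1)%N) ?addnS ?leqW ?leq_addl // -addnS big_split_ord /=.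
rewrite big1 ?add0r => [|i _]; last by rewrite lo // ev2_0.
rewrite big_ord_recl /= addn0 ev2_hcompZ mulrDr; congr (_ + _).
rewrite mulrA mulr_sumr; apply: eq_bigr => i _.
by rewrite ev2_hcompZ /bump /= exprD exprS; ring.
Qed.

(** For fixed [w], let [G] be the bracket of the expansion, as a polynomial in [s]. If it were
    negative at 0, it would be so at a small [s > 0], and so would [Q] at [s] times [w]. *)
Lemma hcomp_ge0 Q m : (forall i, (i < m)%N -> hcomp Q i = 0) ->
  (forall w, 0 <= ev2 Q w) -> forall w, 0 <= ev2 (hcomp Q m) w.
Proof.
move=> lo pos w; have [n hn] := ev2_lowest_expansion lo.
pose T : poly2 := \sum_(i < n) Xvar ^+ i * (ev2 (hcomp Q (m + i.+1)) w)%:P%:P.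
pose G : poly2 := (ev2 (hcomp Q m) w)%:P%:P + Xvar * T.
have GE s : ev2 G (s, 0) = ev2 (hcomp Q m) w +
              s * \sum_(i < n) s ^+ i * ev2 (hcomp Q (m + i.+1)) w.
  rewrite ev2D ev2M ev2_Xvar ev2C hornerC; congr (_ + _ * _).
  by rewrite ev2_sum; apply: eq_bigr => i _; rewrite ev2M ev2X ev2_Xvar ev2C hornerC.
have G0 : ev2 G (0, 0) = ev2 (hcomp Q m) w by rewrite GE mul0r addr0.
rewrite leNgt; apply/negP => neg.
have [|d [d0 hd]] := @continuous2_ev2 G (0, 0) (- ev2 (hcomp Q m) w).
  by rewrite oppr_gt0.
have := hd (d / 2, 0); rewrite /= !subr0 normr0 ger0_norm; last by lra.
move=> /(_ ltac:(lra) d0); rewrite G0 ltr_norml => /andP[_ lt].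
have : 0 <= ev2 Q (d / 2 * w.1, d / 2 * w.2) by apply: pos.
rewrite hn -GE pmulr_rge0; last by rewrite exprn_gt0 //; lra.
lra.
Qed.

(** By homogeneity, a component vanishing in all directions of one chart vanishes off a coordinate
    axis, hence everywhere. *)
Lemma hcomp_neq0_affine Q m : hcomp Q m != 0 ->
  (exists v, ev2 (hcomp Q m) (1, v) != 0) /\ (exists v, ev2 (hcomp Q m) (v, 1) != 0).
Proof.
move=> nz; split; apply: NNPP => no; case/negP: nz; apply/eqP.
  apply: (ev2_eq_of_mul Xvar_neq0) => w; rewrite ev2_Xvar => w0.
  have -> : w = (w.1 * 1, w.1 * (w.2 / w.1)).
    by rewrite mulr1 mulrC mulfVK // -surjective_pairing.
  rewrite (ev2_hcompZ _ _ _ (1, w.2 / w.1)) ev2_0.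
  apply/eqP; rewrite mulf_eq0; apply/orP; right.
  by apply/negPn/negP => h; apply: no; exists (w.2 / w.1).
apply: (@ev2_eq_of_mul Yvar) => [|w]; first by rewrite polyX_eq0.
rewrite ev2_Yvar => w0.
have -> : w = (w.2 * (w.1 / w.2), w.2 * 1).
  by rewrite mulr1 mulrC mulfVK // -surjective_pairing.
rewrite (ev2_hcompZ _ _ _ (w.1 / w.2, 1)) ev2_0.
apply/eqP; rewrite mulf_eq0; apply/orP; right.
by apply/negPn/negP => h; apply: no; exists (w.1 / w.2).
Qed.

End TangentCone.

(* A chart of the blowing-up at [a], with exceptional line [u = 0] in the     *)
(* coordinates [(u, v)]; the direction [(D1, D2)] is [(1, v)] in the first    *)
(* standard chart and [(v, 1)] in the second one, with coordinates exchanged. *)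
Definition bl_param (a : R * R) (D1 D2 : poly2) (w : R * R) : R * R :=
  (a.1 + w.1 * ev2 D1 w, a.2 + w.1 * ev2 D2 w).

(** * The strict transform in one chart *)

Section Chart.
Variables (f : R * R -> R) (p q D1 D2 : poly2) (a : R * R) (m : nat).
Hypothesis lowest : forall i, (i < m)%N -> hcomp (shift2 q a) i = 0.
Hypothesis fq : forall z, f z * ev2 q z = ev2 p z.
Let H := hcomp (shift2 q a) m.
Let beta := bl_param a D1 D2.

Let pull P := comp2 P (a.1%:P%:P + Xvar * D1) (a.2%:P%:P + Xvar * D2).

Let ev2_pull P w : ev2 (pull P) w = ev2 P (beta w).
Proof. by rewrite ev2_comp2 !ev2D !ev2M ev2_Xvar !ev2C !hornerC. Qed.

(** The expansion along the direction [(D1, D2)] with scaling factor u: the power of u comes out,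
    and only the lowest component remains at u = 0. *)
Lemma strict_transform : exists qt : poly2,
  (forall w, ev2 q (beta w) = w.1 ^+ m * ev2 qt w) /\
  (forall v, ev2 qt (0, v) = ev2 H (ev2 D1 (0, v), ev2 D2 (0, v))).
Proof.
have [n hn] := ev2_lowest_expansion lowest.
exists (comp2 H D1 D2 + Xvar * \sum_(i < n) Xvar ^+ i *
          comp2 (hcomp (shift2 q a) (m + i.+1)) D1 D2); split=> [w|v]; last first.
  by rewrite ev2D ev2M ev2_Xvar mul0r addr0 ev2_comp2.
have := hn w.1 (ev2 D1 w, ev2 D2 w); rewrite ev2_shift2 => ->.
rewrite ev2D ev2M ev2_Xvar ev2_comp2; congr (_ * (_ + _ * _)).
by rewrite ev2_sum; apply: eq_bigr => i _; rewrite ev2M ev2X ev2_Xvar ev2_comp2.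
Qed.

Lemma regular_of_tangent_neq0 v : continuous2 f ->
  ev2 H (ev2 D1 (0, v), ev2 D2 (0, v)) != 0 -> regular_at (f \o beta) (0, v).
Proof.
move=> cf Hv; have [qt [hqt qt0]] := strict_transform.
have cb : continuous2 (f \o beta).
  apply: continuous2_ext (continuous2_comp cf
    (continuous2_ev2 (a.1%:P%:P + Xvar * D1)) (continuous2_ev2 (a.2%:P%:P + Xvar * D2))).
  by move=> w; rewrite !ev2D !ev2M ev2_Xvar !ev2C !hornerC.
have [w|P1 hP1] := continuous2_divXn (m := m) (P := pull p)
  (continuous2M cb (continuous2_ev2 qt)).
  by rewrite ev2_pull -fq hqt /=; ring.
by apply: (regular_at_quotient hP1); rewrite qt0.
Qed.

Lemma tangent_neq0_of_regular A B (r : {poly R}) v0 : r != 0 ->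
  (forall w, ev2 A (beta w) * ev2 p (beta w) + ev2 B (beta w) * ev2 q (beta w)
     = r.[w.1]) ->
  (exists v, ev2 H (ev2 D1 (0, v), ev2 D2 (0, v)) != 0) ->
  regular_at (f \o beta) (0, v0) ->
  ev2 H (ev2 D1 (0, v0), ev2 D2 (0, v0)) != 0.
Proof.
move=> rnz bez [v Hv] [U [P [Q [zU [Uz hU]]]]].
have [qt [hqt qt0]] := strict_transform.
have [K [Kz KU]] := zariski_open_basis zU Uz.
apply/negP => /eqP H0; have [/negP[]] := hU _ Uz; apply/eqP.
apply: (@dvd_on_exceptional r Q (Xvar ^+ m * (pull A * P + pull B * Q)) qt) => //.
(* The Bezout relation times [Q], with [f = P / Q] and [f q = p] substituted; it is checked where
   [K] is nonzero. *)
- apply: (ev2_eq_of_mul (ev2_neq0 Kz)) => w /KU /hU [Qw /= fw].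
  rewrite !(ev2M, ev2D, ev2X, ev2_Xvar, ev2C) !ev2_pull -bez -fq hqt fw.
  by field.
- by exists v; rewrite qt0.
- by rewrite qt0.
Qed.

End Chart.

Lemma comp_XaddC_neq0 (A : idomainType) (r : {poly A}) (b : A) : r != 0 -> r \Po ('X + b%:P) != 0.
Proof. by move=> rnz; rewrite comp_poly_eq0 // size_XaddC. Qed.

(** * The two standard charts *)

Section StandardCharts.
Variables (f : R * R -> R) (p q : poly2) (a : R * R) (m : nat).
Hypothesis lowest : forall i, (i < m)%N -> hcomp (shift2 q a) i = 0.
Hypothesis fq : forall z, f z * ev2 q z = ev2 p z.
Let H := hcomp (shift2 q a) m.

Let chart1E : f \o bl_param a 1 Yvar =1 f \o bl_chart1 a.
Proof.
by move=> w; rewrite /= /bl_param ev2_Yvar ev2_1 mulr1.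
Qed.

Let chart2E w : (f \o bl_param a Yvar 1) (w.2, w.1) = (f \o bl_chart2 a) w.
Proof.
by rewrite /= /bl_param ev2_Yvar ev2_1 mulr1 /= [w.2 * _]mulrC.
Qed.

Let dir1 v : (ev2 1 (0, v), ev2 Yvar (0, v)) = (1, v).
Proof. by rewrite ev2_Yvar ev2_1. Qed.

Let dir2 v : (ev2 Yvar (0, v), ev2 1 (0, v)) = (v, 1).
Proof. by rewrite ev2_Yvar ev2_1. Qed.

Lemma regular_chart1 v : continuous2 f ->
  ev2 H (1, v) != 0 -> regular_at (f \o bl_chart1 a) (0, v).
Proof.
move=> cf Hv; apply: regular_at_ext chart1E _.
by apply: (regular_of_tangent_neq0 lowest fq) => //; rewrite dir1.
Qed.

Lemma regular_chart2 t : continuous2 f ->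
  ev2 H (t, 1) != 0 -> regular_at (f \o bl_chart2 a) (t, 0).
Proof.
move=> cf Ht; apply: regular_at_ext chart2E _; apply: regular_at_swap.
by apply: (regular_of_tangent_neq0 lowest fq) => //; rewrite dir2.
Qed.

Lemma tangent1_neq0 v : coprime2 p q -> H != 0 ->
  regular_at (f \o bl_chart1 a) (0, v) -> ev2 H (1, v) != 0.
Proof.
move=> cop Hnz reg; have [A [B [r [rnz e]]]] := coprime2_bezout cop.
(* Here x = a.1 + u, so the shifted [r] depends on u alone. *)
rewrite -dir1; apply: (tangent_neq0_of_regular lowest fq
  (comp_XaddC_neq0 a.1 rnz) (A := A) (B := B)).
- move=> w; rewrite -!ev2M -ev2D e ev2C horner_comp !hornerE /=.
  by rewrite ev2_1 mulr1 addrC.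
- by have [[u Hu] _] := hcomp_neq0_affine Hnz; exists u; rewrite dir1.
- by apply: regular_at_ext reg => w; rewrite chart1E.
Qed.

Lemma tangent2_neq0 t : coprime2 p q -> H != 0 ->
  regular_at (f \o bl_chart2 a) (t, 0) -> ev2 H (t, 1) != 0.
Proof.
move=> cop Hnz reg; have [A [B [r [rnz e]]]] := coprime2_bezoutY cop.
(* With coordinates exchanged, u = y - a.2, so the Bezout relation in y is the one needed. *)
rewrite -dir2; apply: (tangent_neq0_of_regular lowest fq
  (comp_XaddC_neq0 a.2 rnz) (A := A) (B := B)).
- move=> w; rewrite e horner_comp !hornerE /=.
  by rewrite ev2_1 mulr1 addrC.
- by have [_ [u Hu]] := hcomp_neq0_affine Hnz; exists u; rewrite dir2.
- apply: regular_at_ext (regular_at_swap (z := (0, t)) reg) => w.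
  by rewrite -chart2E /= -surjective_pairing.
Qed.

End StandardCharts.

(** * Finiteness of the poles and the equivalence *)

(** The Bezout relations in x and in y confine both coordinates to finite root sets. *)
Lemma common_zeros_finite p q : coprime2 p q ->
  exists S : seq (R * R), forall z, ev2 p z = 0 -> ev2 q z = 0 -> z \in S.
Proof.
move=> cop; have [A [B [r [rnz e]]]] := coprime2_bezout cop.
have [A' [B' [r' [r'nz e']]]] := coprime2_bezoutY cop.
have [xs hx] := roots_finite rnz; have [ys hy] := roots_finite r'nz.
exists [seq (x, y) | x <- xs, y <- ys] => -[x y] pz qz; apply: allpairs_f.
  by apply: hx; rewrite -(ev2C _ (x, y)) -e ev2D !ev2M pz qz !mulr0 addr0.
by apply: hy; rewrite -(e' (x, y)) pz qz !mulr0 addr0.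
Qed.

Theorem theorem3p2 (f : R * R -> R) (p q : poly2) :
  regulous f ->
  coprime2 p q ->
  (forall z, (0 <= ev2 q z)%R) ->
  (forall z, in_dom f z -> ev2 q z != 0%R /\ f z = (ev2 p z / ev2 q z)%R) ->
  (regulous_1stage f <-> (forall a, in_pol f a -> loc_pos_def q a)).
Proof.
move=> reg cop qpos dom.
have [cf [U [P [Q [zU [[z0 Uz0] hU]]]]]] := reg.
have Udom w : U w -> in_dom f w by exists U, P, Q.
have [K [Kz KU]] := zariski_open_basis zU Uz0.
have fq z : f z * ev2 q z = ev2 p z.
  apply/eqP; rewrite -subr_eq0; apply/eqP; move: z.
  apply: (@continuous2_eq0_dense _ K _ (ev2_neq0 Kz)) => [|w /KU/Udom/dom[qw ->]].
    apply: continuous2_ext (continuous2D (continuous2M cf (continuous2_ev2 q))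
      (continuous2_ev2 (- p))) => w; by rewrite ev2N.
  by rewrite divfK // subrr.
have polE a : in_pol f a <-> ev2 q a = 0.
  split=> [pa|qa]; last by case/dom; rewrite qa eqxx.
  by apply/eqP/negPn/negP => qa; apply: pa; apply: regular_at_quotient fq qa.
split=> [[_ [S [hS hC]]] a pa|lpd]; last first.
  split=> //; have [S0 hS0] := common_zeros_finite cop.
  (* The points blown up are the zeros of [q]; since [p = f q], they are common zeros and finite in
     number. *)
  exists [seq z <- S0 | ev2 q z == 0]; split=> [z|a].
    rewrite mem_filter => zS; apply: (regular_at_quotient fq).
    apply: contra zS => /eqP qz; rewrite qz eqxx hS0 //.
    by rewrite -fq qz mulr0.
  rewrite mem_filter => /andP[/eqP qa _].
  have [m [_ [lowest pos]]] := lpd a (proj2 (polE a) qa).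
  have ha x y : (x != 0) || (y != 0) -> ev2 (hcomp (shift2 q a) m) (x, y) != 0.
    move=> xy; have := pos (x + a.1, y + a.2); rewrite /= !addrK => h.
    rewrite gt_eqF // h //; apply: contraL xy => /eqP e.
    have -> : x = 0 by apply: (addIr a.1); rewrite add0r; exact: (congr1 fst e).
    have -> : y = 0 by apply: (addIr a.2); rewrite add0r; exact: (congr1 snd e).
    by rewrite eqxx.
  split=> v; [apply: (regular_chart1 lowest fq)|apply: (regular_chart2 lowest fq)] => //.
    by apply: ha; rewrite oner_eq0.
  by apply: ha; rewrite oner_eq0 orbT.
(* Off [S] the function is regular, which a pole excludes. *)
have aS : a \in S by apply/negPn/negP => /hS.
have [reg1 reg2] := hC a aS.
have snz : shift2 q a != 0.
  apply: (@ev2_neq0 _ (z0.1 - a.1, z0.2 - a.2)).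
  rewrite ev2_shift2 /= !(addrC a.1) !(addrC a.2) !subrK -surjective_pairing.
  by case: (dom z0 (Udom _ Uz0)).
have [m [Hnz lowest]] := lowest_hcomp snz.
exists m; split=> //; split=> // w wa.
(* Nonnegativity comes from [q >= 0], so only nonvanishing in each direction is left. *)
rewrite lt_neqAle eq_sym hcomp_ge0 ?andbT => [|//|z]; last by rewrite ev2_shift2.
set x := w.1 - a.1; set y := w.2 - a.2.
(* The vertical direction is the origin of the second chart; any other has slope [y / x] in the
   first. *)
have [x0|xnz] := eqVneq x 0.
  have ynz : y != 0.
    apply: contraNneq wa => y0; rewrite [w]surjective_pairing [a]surjective_pairing.
    by rewrite -(subrK a.1 w.1) -(subrK a.2 w.2) -/x -/y x0 y0 !add0r.
  have -> : (x, y) = (y * 0, y * 1) by rewrite mulr0 mulr1 x0.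
  rewrite (ev2_hcompZ _ _ _ (0, 1)) mulf_neq0 ?expf_neq0 //.
  exact: (tangent2_neq0 lowest fq).
have -> : (x, y) = (x * 1, x * (y / x)) by rewrite mulr1 mulrC mulfVK.
rewrite (ev2_hcompZ _ _ _ (1, y / x)) mulf_neq0 ?expf_neq0 //.
exact: (tangent1_neq0 lowest fq).
Qed.
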